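(* The element $\nabla\langle a\rangle\in\mathfrak H_2$ is not propositionally representable; i.e. there is no formula $\varphi$ of intuitionistic propositional logic in the two variables $a,b$ with $\langle[\varphi]\rangle=\nabla\langle a\rangle$.
   Context: $F_2$ is the free Heyting algebra on two generators $a,b$: formulas of intuitionistic propositional logic in variables $a,b$ modulo provable equivalence; $[\varphi]$ is the class of $\varphi$. Bellissima model. Let $K_{2,-1}=\emptyset$ and $K_{2,0}=\{(\{a,b\},\emptyset),(\{a\},\emptyset),(\{b\},\emptyset),(\emptyset,\emptyset)\}$. For $n\ge 0$, $K_{2,n+1}$ is the union of $K_{2,n}$ with the set of all pairs $(\beta,Y)$ with $\beta\subseteq\{a,b\}$ and $Y\subseteq K_{2,n}$ such that $Y\setminus K_{2,n-1}$ is inhabited and for all $(\beta',Y')\in Y$: (1) $Y'\subseteq Y$; (2) $\beta\subseteq\beta'$; (3) if $Y=Y'\cup\{(\beta',Y')\}$ then $\beta\subsetneq\beta'$. Let $K_2=\bigcup_{n\in\mathbb N}K_{2,n}$, with strict order $(\beta,Y)<(\gamma,Z)$ iff $(\gamma,Z)\in Y$, with $\le$ its reflexive closure (a partial order), and with valuation $\nu(\beta,Y)=\beta$. This is an intuitionistic Kripke model, with $w\Vdash a$ iff $a\in\nu(w)$, $w\Vdash b$ iff $b\in\nu(w)$, and the usual forcing clauses. $\mathfrak H_2$ is the complete Heyting algebra of upward-closed subsets of $(K_2,\le)$, ordered by inclusion. The map $\langle-\rangle:F_2\to\mathfrak H_2$ is $\langle[\varphi]\rangle=\{w\in K_2: w\Vdash\varphi\}$;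 $\langle a\rangle$ abbreviates $\langle[a]\rangle$. Elements of the form $\langle[\varphi]\rangle$ are called propositionally representable. On a complete Heyting algebra $(H,\sqsubseteq)$, the point-free coderivative is $\nabla(x)=\inf_{y\in H}\bigl(y\sqcup(y\Rightarrow x)\bigr)$. *)

(* Defs.v *)
From HB Require Import structures.
From mathcomp Require Import all_boot all_order finmap.
From mathcomp Require Import boolp classical_sets cardinality.

Set Implicit Arguments.
Unset Strict Implicit.
Unset Printing Implicit Defensive.

Import Order.TTheory.

Local Open Scope classical_set_scope.
Local Open Scope order_scope.
Local Open Scope quotient_scope.

(** * Complete Heyting algebras and the point-free coderivative *)

#[key="T"]
HB.mixin Record isHeyting d T of Order.TBLattice d T := {
  imp : T -> T -> T;
  le_imp : forall x y z : T, (z <= imp x y) = (z `&` x <= y)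
}.

#[short(type="heytingType")]
HB.structure Definition Heyting d := { T of Order.TBLattice d T & isHeyting d T }.

(* Suprema of arbitrary subsets are not part of the data: they exist as infima
   of sets of upper bounds. *)
#[key="T"]
HB.mixin Record hasInf d T of Order.TBLattice d T := {
  inf : set T -> T;
  le_inf : forall (A : set T) (z : T), (z <= inf A) <-> (forall x, A x -> z <= x)
}.

#[short(type="cHeytingType")]
HB.structure Definition CHeyting d := { T of Heyting d T & hasInf d T }.

Definition nabla d (H : cHeytingType d) (x : H) : H :=
  inf [set (y `|` imp y x)%O | y in [set: H]].

(** * The complete Heyting algebra of upward-closed subsets of a poset *)

Fact upset_display : Order.disp_t. Proof. by []. Qed.

Section Upsets.
Context {d : Order.disp_t} (P : porderType d).

Definition upclosed : {pred set P} :=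
  [pred U : set P | `[< forall v w : P, v <= w -> U v -> U w >]].

Record upset := Upset { upset_set : set P; upset_closed : upset_set \in upclosed }.

HB.instance Definition _ := [isSub for upset_set].
HB.instance Definition _ := [Choice of upset by <:].

Lemma upclosedP (U : set P) :
  reflect (forall v w : P, v <= w -> U v -> U w) (U \in upclosed).
Proof. exact: asboolP. Qed.

Fact upclosed_meet : {in upclosed &, forall U V, U `&` V \in upclosed}%O.
Proof.
move=> U V /upclosedP UU /upclosedP VV; apply/upclosedP => v w vw [Uv Vv].
by split; [apply: UU Uv | apply: VV Vv].
Qed.

Fact upclosed_join : {in upclosed &, forall U V, U `|` V \in upclosed}%O.
Proof.
move=> U V /upclosedP UU /upclosedP VV; apply/upclosedP => v w vw [Uv|Vv].
- by left; apply: UU Uv.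
- by right; apply: VV Vv.
Qed.

Fact upclosed_bot : \bot \in upclosed.
Proof. exact/upclosedP. Qed.

Fact upclosed_top : \top \in upclosed.
Proof. exact/upclosedP. Qed.

(* This makes [upset] a bounded sublattice of [set P] ordered by inclusion, with
   intersection and union as meet and join. *)
HB.instance Definition _ := Order.SubChoice_isTBSubLattice.Build
  set_display (set P) upclosed upset_display upset
  upclosed_meet upclosed_join upclosed_bot upclosed_top.

Lemma le_upsetP (U V : upset) : reflect (upset_set U `<=` upset_set V) (U <= V).
Proof. exact: asboolP. Qed.

Lemma upsetP (U : upset) (v w : P) :
  v <= w -> upset_set U v -> upset_set U w.
Proof. by move: v w; apply/upclosedP/upset_closed. Qed.

Fact upset_imp_closed (U V : upset) :
  [set v | forall w, v <= w -> upset_set U w -> upset_set V w] \in upclosed.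
Proof.
by apply/upclosedP => v w vw /= UV u wu; apply: UV; apply: le_trans wu.
Qed.

Definition upset_imp (U V : upset) : upset := Upset (upset_imp_closed U V).

Fact le_upset_imp (U V W : upset) : (W <= upset_imp U V) = (W `&` U <= V).
Proof.
apply/le_upsetP/le_upsetP => [WUV v [Wv Uv]|WUV v Wv w vw Uw].
- exact: (WUV v Wv v).
- by apply: WUV; split => //; apply: upsetP Wv.
Qed.

HB.instance Definition _ := isHeyting.Build upset_display upset le_upset_imp.

Fact upset_inf_closed (A : set upset) :
  [set v | forall U : upset, A U -> upset_set U v] \in upclosed.
Proof. by apply/upclosedP => v w vw /= Av U AU; apply: upsetP vw (Av U AU). Qed.

Definition upset_inf (A : set upset) : upset := Upset (upset_inf_closed A).

Fact le_upset_inf (A : set upset) (W : upset) :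
  (W <= upset_inf A) <-> (forall U, A U -> W <= U).
Proof.
split=> [/le_upsetP WA U AU|WA]; apply/le_upsetP => v Wv.
- exact: WA.
- by move=> U /WA /le_upsetP; apply.
Qed.

HB.instance Definition _ := hasInf.Build upset_display upset le_upset_inf.

End Upsets.

Arguments upclosed {d P}.

(** * Intuitionistic propositional logic in the variables a, b *)

Inductive gen := ga | gb.

Definition bool_of_gen (g : gen) := if g is ga then true else false.
Definition gen_of_bool (x : bool) := if x then ga else gb.
Fact bool_of_genK : cancel bool_of_gen gen_of_bool. Proof. by case. Qed.
HB.instance Definition _ := Finite.copy gen (can_type bool_of_genK).

Inductive form :=
| Bot
| Var of gen
| And of form & form
| Or of form & form
| Imp of form & form.

HB.instance Definition _ := gen_eqMixin form.
HB.instance Definition _ := gen_choiceMixin form.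

Inductive entails (G : seq form) : form -> Prop :=
| entails_ax p : p \in G -> entails G p
| entails_botE p : entails G Bot -> entails G p
| entails_andI p q : entails G p -> entails G q -> entails G (And p q)
| entails_andEl p q : entails G (And p q) -> entails G p
| entails_andEr p q : entails G (And p q) -> entails G q
| entails_orIl p q : entails G p -> entails G (Or p q)
| entails_orIr p q : entails G q -> entails G (Or p q)
| entails_orE p q r : entails G (Or p q) ->
    entails (p :: G) r -> entails (q :: G) r -> entails G r
| entails_impI p q : entails (p :: G) q -> entails G (Imp p q)
| entails_impE p q : entails G (Imp p q) -> entails G p -> entails G q.

Lemma entails_weaken G G' p :
  {subset G <= G'} -> entails G p -> entails G' p.
Proof.
have sub_cons (x : form) (s s' : seq form) :
    {subset s <= s'} -> {subset x :: s <= x :: s'}.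
  by move=> ss' y; rewrite !inE => /orP[->//|/ss' ->]; rewrite orbT.
move=> GG' H; elim: H G' GG' => {G p}.
- by move=> G p pG G' GG'; apply/entails_ax/GG'.
- by move=> G p _ IH G' GG'; apply/entails_botE/IH.
- by move=> G p q _ IH _ IH' G' GG'; apply: entails_andI; [apply: IH|apply: IH'].
- by move=> G p q _ IH G' GG'; apply: entails_andEl (IH _ GG').
- by move=> G p q _ IH G' GG'; apply: entails_andEr (IH _ GG').
- by move=> G p q _ IH G' GG'; apply/entails_orIl/IH.
- by move=> G p q _ IH G' GG'; apply/entails_orIr/IH.
- move=> G p q r _ IH _ IHp _ IHq G' GG'.
  by apply: (entails_orE (IH _ GG')); [apply: IHp|apply: IHq]; apply: sub_cons.
- by move=> G p q _ IH G' GG'; apply/entails_impI/IH/sub_cons.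
- by move=> G p q _ IH _ IH' G' GG'; apply: entails_impE (IH _ GG') (IH' _ GG').
Qed.

Definition prov_eq (p q : form) : bool :=
  `[< entails [:: p] q /\ entails [:: q] p >].

Lemma entails_cut p q r : entails [:: p] q -> entails [:: q] r -> entails [:: p] r.
Proof.
move=> pq qr; apply: (entails_impE _ pq); apply: entails_impI.
by apply: entails_weaken qr => x; rewrite !inE => ->; rewrite eqxx.
Qed.

Fact prov_eq_refl : reflexive prov_eq.
Proof. by move=> p; apply/asboolP; split; apply/entails_ax; rewrite inE. Qed.

Fact prov_eq_sym : symmetric prov_eq.
Proof. by move=> p q; apply/asboolP/asboolP => -[]. Qed.

Fact prov_eq_trans : transitive prov_eq.
Proof.
move=> q p r /asboolP[pq qp] /asboolP[qr rq]; apply/asboolP.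
by split; [apply: entails_cut pq qr|apply: entails_cut rq qp].
Qed.

Canonical prov_eq_equiv := EquivRel prov_eq prov_eq_refl prov_eq_sym prov_eq_trans.

Definition F2 := {eq_quot prov_eq}.
HB.instance Definition _ := Choice.on F2.
HB.instance Definition _ := EqQuotient.on F2.

Definition cls (p : form) : F2 := \pi_F2 p.

(** * The Bellissima model *)

(* The elements of the model are hereditarily finite: the pair of a finite label
   set and a finite set of previously coded pairs is coded by a natural number
   through the injection [pickle].  Codes outside the range of [node] or not
   reached by [K_] play no role. *)
Definition node (beta : {set gen}) (Y : {fset nat}) : nat := choice.pickle (beta, Y).

Definition unnode (w : nat) : {set gen} * {fset nat} :=
  odflt (finset.set0, fset0) (choice.unpickle w).
Definition label (w : nat) : {set gen} := (unnode w).1.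
Definition above (w : nat) : {fset nat} := (unnode w).2.

Lemma nodeK beta Y : unnode (node beta Y) = (beta, Y).
Proof. by rewrite /unnode /node choice.pickleK. Qed.

Lemma label_node beta Y : label (node beta Y) = beta.
Proof. by rewrite /label nodeK. Qed.

Lemma above_node beta Y : above (node beta Y) = Y.
Proof. by rewrite /above nodeK. Qed.

Lemma node_inj beta Y beta' Y' :
  node beta Y = node beta' Y' -> beta = beta' /\ Y = Y'.
Proof. by move/(congr1 unnode); rewrite !nodeK => -[-> ->]. Qed.

(* The pairs added at stage n + 1, where X is stage n and X' stage n - 1. *)
Definition new_nodes (X X' : set nat) : set nat :=
  [set w | exists beta Y, [/\ w = node beta Y,
     [set` Y] `<=` X,
     [set` Y] `\` X' !=set0 &
     forall beta' Y', node beta' Y' \in Y ->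
       [/\ (Y' `<=` Y)%fset,
           beta \subset beta' &
           Y = (Y' `|` [fset node beta' Y'])%fset -> beta \proper beta']]].

(* The index is shifted: [K_ n] is the stage $K_{2,n-1}$. *)
Fixpoint K_ (n : nat) : set nat :=
  match n with
  | 0 => set0
  | m.+1 => match m with
            | 0 => [set node beta fset0 | beta in [set: {set gen}]]
            | k.+1 => K_ m `|` new_nodes (K_ m) (K_ k)
            end
  end.

Definition K2 : set nat := \bigcup_n K_ n.

(* Hence letting Y range over finite sets in [new_nodes] loses nothing. *)
Lemma K_finite n : finite_set (K_ n).
Proof.
elim/ltn_ind: n => -[_|[_|n IH]]; first exact: finite_set0.
  exact/finite_image/finite_finset.
rewrite [K_ _]/(K_ n.+1 `|` new_nodes (K_ n.+1) (K_ n)) finite_setU.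
split; first exact: IH.
have /finite_fsetP[A KA] : finite_set (K_ n.+1) by apply: IH.
apply: (@sub_finite_set _ _
  [set node u.1 u.2 | u in [set: {set gen}] `*` [set` fpowerset A]]).
  move=> w [beta [Y [-> YK _ _]]]; exists (beta, Y) => //; split => //=.
  rewrite fpowersetE; apply/fsubsetP => x xY.
  by have := YK x xY; rewrite KA.
by apply/finite_image/finite_setX => //; apply: finite_finset.
Qed.

Lemma K_above n (v w : nat) : K_ n.+1 w -> v \in above w -> K_ n v.
Proof.
elim: n w => [|n IH] w /=; first by move=> [beta _ <-]; rewrite above_node.
case=> [Kw vw|[beta [Y [-> YK _ _]]]]; last by rewrite above_node => /YK.
by move: (IH _ Kw vw); case: n {IH Kw} => //= n; left.
Qed.

Lemma K_le_above n (u v w : nat) :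
  K_ n w -> v \in above w -> u \in above v -> u \in above w.
Proof.
elim/ltn_ind: n w => -[_ w []|[_ w|n IH w]] /=.
  by move=> [beta _ <-]; rewrite above_node.
case=> [Kw|[beta [Y [-> YK _ YY]]]]; first exact: (IH n.+1).
rewrite above_node => vY uv.
have [beta' [Y' vE]] : exists beta' Y', v = node beta' Y'.
  move: (YK v vY); elim: n {IH YK} => [|n IHn] /=.
    by move=> [b _ <-]; exists b, fset0.
  by case=> // -[b [Z [-> _ _ _]]]; exists b, Z.
have [/fsubsetP sub _ _] := YY beta' Y' (eq_ind _ (fun x => x \in Y) vY _ vE).
by apply: sub; rewrite -(above_node beta' Y') -vE.
Qed.

Lemma K_le_label n (v w : nat) :
  K_ n w -> v \in above w -> label w \subset label v.
Proof.
elim/ltn_ind: n w => -[_ w []|[_ w|n IH w]] /=.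
  by move=> [beta _ <-]; rewrite above_node.
case=> [Kw|[beta [Y [-> YK _ YY]]]]; first exact: (IH n.+1).
rewrite above_node label_node => vY.
have [beta' [Y' vE]] : exists beta' Y', v = node beta' Y'.
  move: (YK v vY); elim: n {IH YK} => [|n IHn] /=.
    by move=> [b _ <-]; exists b, fset0.
  by case=> // -[b [Z [-> _ _ _]]]; exists b, Z.
have [_ sub _] := YY beta' Y' (eq_ind _ (fun x => x \in Y) vY _ vE).
by rewrite vE label_node.
Qed.

Lemma K_above_asym n (v w : nat) :
  K_ n w -> v \in above w -> w \in above v -> False.
Proof.
elim: n v w => [//|n IH] v w Kw vw wv.
exact: IH (K_above Kw vw) wv vw.
Qed.

Definition world := set_type K2.
HB.instance Definition _ := Choice.on world.

Definition world_le (v w : world) : bool := (v == w) || (val w \in above (val v)).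

Lemma world_K (w : world) : exists n, K_ n (val w).
Proof. by have /set_mem[n _ Kn] := valP w; exists n. Qed.

Fact world_le_refl : reflexive world_le.
Proof. by move=> w; rewrite /world_le eqxx. Qed.

Fact world_le_anti : antisymmetric world_le.
Proof.
move=> v w /andP[/orP[/eqP//|vw] /orP[/eqP//|wv]].
by have [n Kv] := world_K v; case: (K_above_asym Kv vw wv).
Qed.

Fact world_le_trans : transitive world_le.
Proof.
move=> v u w /orP[/eqP->//|uv] /orP[/eqP<-|vw]; apply/orP; right => //.
by have [n Ku] := world_K u; apply: K_le_above Ku uv vw.
Qed.

Fact world_display : Order.disp_t. Proof. by []. Qed.

HB.instance Definition _ := Order.Le_isPOrder.Build world_display world
  world_le_refl world_le_anti world_le_trans.

Fixpoint forces (w : world) (p : form) : Prop :=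
  match p with
  | Bot => False
  | Var g => g \in label (val w)
  | And p q => forces w p /\ forces w q
  | Or p q => forces w p \/ forces w q
  | Imp p q => forall v, w <= v -> forces v p -> forces v q
  end.

Lemma forces_mono p (v w : world) : v <= w -> forces v p -> forces w p.
Proof.
elim: p v w => [//|g|p IHp q IHq|p IHp q IHq|p _ q _] v w vw /=.
- case/orP: vw => [/eqP->//|vw]; have [n Kv] := world_K v.
  exact/fintype.subsetP/(K_le_label Kv vw).
- by move=> [vp vq]; split; [apply: IHp vp|apply: IHq vq].
- by case=> [vp|vq]; [left; apply: IHp vp|right; apply: IHq vq].
- by move=> H u wu; apply: H; apply: le_trans wu.
Qed.

Lemma forces_sound G p : entails G p ->
  forall w, (forall q, q \in G -> forces w q) -> forces w p.
Proof.
have consG (x : form) (s : seq form) w : forces w x ->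
    (forall q, q \in s -> forces w q) -> forall q, q \in x :: s -> forces w q.
  by move=> wx ws q; rewrite inE => /orP[/eqP->|/ws].
elim=> {G p} //=.
- by move=> G p pG w; apply.
- by move=> G p _ IH w /IH.
- by move=> G p q _ IH _ IH' w wG; split; [apply: IH|apply: IH'].
- by move=> G p q _ IH w /IH [].
- by move=> G p q _ IH w /IH [].
- by move=> G p q _ IH w /IH; left.
- by move=> G p q _ IH w /IH; right.
- move=> G p q r _ IH _ IHp _ IHq w wG.
  by case: (IH w wG) => H; [apply: IHp|apply: IHq]; apply: consG.
- move=> G p q _ IH w wG v wv vp; apply: IH; apply: consG => // r rG.
  exact: forces_mono wv (wG r rG).
- by move=> G p q _ IH _ IH' w wG; apply: (IH w wG w) => //; apply: IH'.
Qed.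

Notation H2 := (upset world).

Fact truth_closed (p : form) : [set w : world | forces w p] \in upclosed.
Proof. by apply/upclosedP => v w vw; apply: forces_mono. Qed.

Definition truth_set (p : form) : H2 := Upset (truth_closed p).

(* Independent of the choice of representative, by [interp_cls]. *)
Definition interp (x : F2) : H2 := truth_set (repr x).

Lemma interp_cls (p : form) : interp (cls p) = truth_set p.
Proof.
have /asboolP[pq qp] : prov_eq p (repr (cls p)).
  by apply/(eqmodP prov_eq_equiv); rewrite reprK.
apply: val_inj; apply/seteqP; split=> w /= wp.
- by apply: (forces_sound qp) => r; rewrite mem_seq1 => /eqP->.
- by apply: (forces_sound pq) => r; rewrite mem_seq1 => /eqP->.
Qed.

Definition prop_representable (U : H2) : Prop :=
  exists p : form, interp (cls p) = U.

(* Main.v *)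
Require Import Defs.
From mathcomp Require Import all_boot all_order finmap.
From mathcomp Require Import boolp classical_sets.

(** A world lies in [nabla U] iff all its strict successors lie in [U].  The
worlds forcing [a] contain an infinite ladder [y_0, y_1, ...], with
[y_0 = ({a,b}, set0)] and [y_(k+1) = ({a}, A_k)],
in which every initial segment [A_k = {y_0, ..., y_(k-1)}] is upward closed.
Given a formula [f], pick [i < m] such that [y_i] and [y_m] force the same
subformulas of [f].  The worlds [p = (set0, A_m)] and [q = (set0, A_(m+1) + {p})] then
force the same subformulas of [f], since the only point above [q] that is neither
[q] nor above [p] is [y_m], which is mimicked by [y_i].  But [p] is in
[nabla <a>] and [q], which lies strictly below [p], is not. *)

Set Implicit Arguments.
Unset Strict Implicit.
Unset Printing Implicit Defensive.

Import Order.TTheory.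

(** Testing the infimum at the set of strict successors of [v] excludes the first disjunct, since
    [v] is not in that set, and leaves the implication. Conversely, if [v] is not in [Y], every
    point of [Y] above [v] is a strict successor. *)
Lemma nabla_upsetP d (P : porderType d) (U : upset P) (v : P) :
  upset_set (nabla U) v <-> forall w, (v < w)%O -> upset_set U w.
Proof.
split=> [Uv w vw|Uv _ [Y _ <-]].
- have Yup : [set u | (v < u)%O]%classic \in @upclosed _ P.
    by apply/upclosedP => x y xy /= vx; apply: lt_le_trans xy.
  have /= := Uv _ (ex_intro2 _ _ (Upset Yup) I erefl).
  by case=> [/=|/(_ w (ltW vw))]; [rewrite ltxx|apply].
- have [Yv|nYv] := pselect (upset_set Y v); first by left.
  right=> w vw Yw; apply: Uv; rewrite lt_neqAle vw andbT.
  by apply/eqP => vE; apply: nYv; rewrite vE.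
Qed.

Lemma pigeonhole (T : finType) (f : nat -> T) :
  exists i j, i < j /\ f i = f j.
Proof.
have /injectivePn[x [y xy fxy]] : ~~ injectiveb (fun k : 'I_#|T|.+1 => f k).
  by apply/injectiveP => /leq_card; rewrite card_ord ltnn.
have [lt|lt|/val_inj E] := ltngtP x y; last by rewrite E eqxx in xy.
- by exists x, y.
- by exists y, x.
Qed.

Lemma K_sub n m : n <= m -> (K_ n `<=` K_ m)%classic.
Proof.
move=> /subnK <-; elim: (m - n) => [//|k IH] w /IH.
by rewrite addSn; case: (k + n) => [//|j Kw]; left.
Qed.

Lemma K2_leaf beta : K2 (node beta fset0).
Proof. by exists 1 => //; exists beta. Qed.

Lemma K2_node (beta : {set gen}) (Y : {fset nat}) (x : nat) : x \in Y ->
  (forall y, y \in Y -> K2 y) ->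
  (forall (beta' : {set gen}) (Y' : {fset nat}), node beta' Y' \in Y ->
     [/\ (Y' `<=` Y)%fset, beta \subset beta' &
         Y = (Y' `|` [fset node beta' Y'])%fset -> beta \proper beta']) ->
  K2 (node beta Y).
Proof.
move=> xY YK cond.
have exn : exists n, `[< forall y, y \in Y -> K_ n y >].
  have /boolp.choice[f fP] : forall y : nat, exists n, y \in Y -> K_ n y.
    move=> y; have [/YK[n _ Kn]|_] := boolP (y \in Y); last by exists 0.
    by exists n.
  exists (\max_(y <- Y) f y); apply/asboolP => y yY.
  by apply: K_sub (fP y yY); apply: leq_bigmax_seq.
(* The least stage containing [Y] is not the empty stage 0, because [x] is in [Y]. Minimality then
   supplies the element of [Y] outside the preceding stage. *)
case: (ex_minnP exn) => -[|n] /asboolP Yn min; first by case: (Yn x xY).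
exists n.+2 => //; right; exists beta, Y; split=> //.
have /asboolPn/existsNP[y /not_implyP[yY nKy]] :
    ~~ `[< forall y, y \in Y -> K_ n y >].
  by apply/negP => /min; rewrite ltnn.
by exists y.
Qed.

Section Ladder.

(* [ladder k] is the pair [(A_k, y_k)]. *)
Fixpoint ladder (k : nat) : {fset nat} * nat :=
  if k is j.+1
  then (((ladder j).2 |` (ladder j).1)%fset, node (finset.set1 ga) (ladder j).1)
  else (fset0, node [set: gen] fset0).

Local Notation A k := (ladder k).1.
Local Notation y k := (ladder k).2.

Lemma in_ladder k x : reflect (exists2 i, i < k & x = y i) (x \in A k).
Proof.
elim: k x => [|k IH] x /=; first by rewrite inE; apply: ReflectF => -[].
rewrite in_fset1U; apply: (iffP orP) => [[/eqP->|/IH[i ik ->]]|[i]].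
- by exists k.
- by exists i => //; apply: ltnW.
- by rewrite ltnS leq_eqVlt => /predU1P[->|ik] ->; [left|right; apply/IH; exists i].
Qed.

Lemma ladder_mem i k : i < k -> y i \in A k.
Proof. by move=> ik; apply/in_ladder; exists i. Qed.

Lemma ladder_sub i k : i <= k -> (A i `<=` A k)%fset.
Proof.
move=> ik; apply/fsubsetP => _ /in_ladder[j ji ->].
by apply: ladder_mem; apply: leq_trans ik.
Qed.

Lemma above_ladder k : above (y k) = A k.-1.
Proof. by case: k => [|k]; rewrite above_node. Qed.

Lemma label_ladder k :
  label (y k) = if k is 0 then [set: gen]%SET else finset.set1 ga.
Proof. by case: k => [|k]; rewrite label_node. Qed.

Lemma node_ladder k : y k = node (label (y k)) (A k.-1).
Proof. by case: k => [|k] /=; rewrite label_node. Qed.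

Lemma ga_ladder k : ga \in label (y k).
Proof. by rewrite label_ladder; case: k => [|k]; rewrite inE. Qed.

(** Equal nodes have equal successor sets: [y_(k+1) = y_(i+1)] with [i < k] would put [y_i] in
    [A_k = A_i], a failure at a smaller index. The label separates [y_0] from the other rungs. *)
Lemma ladder_fresh k : y k \notin A k.
Proof.
elim/ltn_ind: k => k IH; apply/in_ladder => -[[|i] ik yE].
- move/(congr1 label): yE; rewrite !label_ladder; case: k ik {IH} => // k _.
  by move/setP/(_ gb); rewrite !inE.
- case: k ik yE IH => // k ik /(congr1 above); rewrite !above_ladder /= => AE IH.
  by have := ladder_mem (ik : i < k); rewrite AE; apply/negP/IH/ltnW.
Qed.

Lemma K2_ladder k : K2 (y k).
Proof.
elim/ltn_ind: k => -[|[|k]] IH; [exact: K2_leaf..|].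
apply: (@K2_node _ (A k.+1) (y 0)); first exact: ladder_mem.
  by move=> _ /in_ladder[i ik ->]; apply/IH/leqW.
move=> beta' Y' /in_ladder[j jk] vE; move: (vE); rewrite node_ladder.
move=> /node_inj[-> ->]; rewrite -node_ladder label_ladder; split.
- by apply: ladder_sub; apply: leq_trans (leq_pred j) (ltnW jk).
- by apply/fintype.subsetP => g; case: j {vE jk}; rewrite !inE.
(* Clause (3): for [y_0] the label strictly grows. No [y_(j+1)] generates the whole set, since [y_j]
   is neither above it nor equal to it. *)
- case: j vE jk => [|j] _ jk AE.
    by rewrite properE; apply/andP; split; apply/fintype.subsetP => //= /(_ gb);
       rewrite !inE => /(_ isT).
  have : y j \in A k.+1 by apply/ladder_mem/ltnW.
  rewrite AE inE (negbTE (ladder_fresh j)) inE => /eqP yE.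
  by have := ladder_fresh j.+1; rewrite -yE ladder_mem.
Qed.

Lemma ladder_succ k beta Y : node beta Y \in A k -> (Y `<=` A k)%fset.
Proof.
move=> /in_ladder[j jk]; rewrite node_ladder => /node_inj[_ ->].
by apply: ladder_sub; apply: leq_trans (leq_pred j) (ltnW jk).
Qed.

Lemma ga_in_ladder k beta Y : node beta Y \in A k -> ga \in beta.
Proof.
move=> /in_ladder[j jk vE]; move: (ga_ladder j).
by rewrite -vE label_node.
Qed.

Lemma ga_proper (beta : {set gen}) : ga \in beta -> finset.set0 \proper beta.
Proof. by move=> gab; rewrite proper0; apply/finset.set0Pn; exists ga. Qed.

Definition base (m : nat) := node finset.set0 (A m).

Lemma K2_base m : 0 < m -> K2 (base m).
Proof.
move=> m0; apply: (@K2_node _ (A m) (y 0)); first exact: ladder_mem.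
  by move=> _ /in_ladder[i _ ->]; apply: K2_ladder.
move=> beta Y wA; split; [exact: ladder_succ wA|exact: finset.sub0set|].
by move=> _; apply/ga_proper/ga_in_ladder/wA.
Qed.

Lemma base_notin_ladder m k : base m \notin A k.
Proof. by apply/negP => /ga_in_ladder; rewrite inE. Qed.

Definition below_base (m : nat) := node finset.set0 (base m |` A m.+1)%fset.

Lemma K2_below_base m : 0 < m -> K2 (below_base m).
Proof.
move=> m0; apply: (@K2_node _ _ (base m)); first by rewrite in_fset1U eqxx.
  move=> x; rewrite in_fset1U => /predU1P[->|]; first exact: K2_base.
  by move=> /in_ladder[i _ ->]; apply: K2_ladder.
move=> beta Y; rewrite in_fset1U => /orP[/eqP/node_inj[-> ->]|wA].
- split; [|exact: finset.sub0set|].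
    by apply/fsubsetP => x xA; rewrite !in_fset1U xA !orbT.
  (* [base m] also has the empty label, so clause (3) requires that it not generate the whole set;
     the extra rung [y_m] ensures this. *)
  move/fsetP/(_ (y m)); rewrite !inE eqxx orbT (negbTE (ladder_fresh m)) /=.
  move=> /esym/eqP yE.
  by have := base_notin_ladder m m.+1; rewrite /base -yE ladder_mem.
- split; [|exact: finset.sub0set|].
    by apply: fsubset_trans (ladder_succ wA) (fsubsetUr _ _).
  by move=> _; apply/ga_proper/ga_in_ladder/wA.
Qed.

End Ladder.

Definition to_world w (Kw : K2 w) : world := exist _ w (mem_set Kw).

Lemma world_leE (v w : world) : (v <= w)%O = (v == w) || (val w \in above (val v)).
Proof. by []. Qed.

Fixpoint subformulas (f : form) : seq form :=
  f :: match f with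
       | And f1 f2 | Or f1 f2 | Imp f1 f2 => subformulas f1 ++ subformulas f2
       | _ => [::]
       end.

Lemma subformulas_refl f : f \in subformulas f.
Proof. by case: f => *; rewrite inE eqxx. Qed.

(** Only implication looks beyond [q] itself. A point above [q] is either [q], where the induction
    hypotheses pass through [p], or has a stand-in above [p] agreeing on both immediate
    subformulas. *)
Lemma forces_indist (p q : world) (f : form) : (q <= p)%O ->
  label (val q) = label (val p) ->
  (forall v, (q <= v)%O -> v = q \/
     exists2 u, (p <= u)%O &
       {in subformulas f, forall g, forces u g <-> forces v g}) ->
  forces q f <-> forces p f.
Proof.
move=> qp lab; elim: f => [|g|f IHf g IHg|f IHf g IHg|f IHf g IHg] cov //=.
- by rewrite lab.
all: have covS (S : seq form) : {subset S <= subformulas f ++ subformulas g} ->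
  forall v, (q <= v)%O -> v = q \/ exists2 u, (p <= u)%O &
    {in S, forall h, forces u h <-> forces v h} by
  move=> subS v /cov[->|[u pu uv]]; [left|right; exists u] => // h /subS hS;
  apply: uv; rewrite inE hS orbT.
all: have {IHf} IHf : forces q f <-> forces p f by
  apply/IHf/covS => h hf; rewrite mem_cat hf.
all: have {IHg} IHg : forces q g <-> forces p g by
  apply/IHg/covS => h hg; rewrite mem_cat hg orbT.
- by rewrite IHf IHg.
- by rewrite IHf IHg.
split=> [qfg v pv|pfg v qv vf]; first by apply: qfg; apply: le_trans pv.
case: (covS _ (fun _ => id) v qv) => [vq|[u pu uv]].
- by rewrite vq in vf *; apply/IHg/pfg => //; apply/IHf.
- apply/uv; first by rewrite mem_cat subformulas_refl orbT.
  by apply: pfg => //; apply/uv => //; rewrite mem_cat subformulas_refl.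
Qed.

Theorem proposition4p8 :
  ~ prop_representable (nabla (interp (cls (Var ga)))).
Proof.
case=> f; rewrite !interp_cls => fE.
have fP w : forces w f <-> forall v, (w < v)%O -> ga \in label (val v).
  by rewrite -(nabla_upsetP (truth_set (Var ga))) -fE.
(* Truth values on the subformulas form a Boolean tuple of fixed length, hence an element of a
   finite type. *)
pose theory w := map_tuple (fun g => `[< forces w g >]) (in_tuple (subformulas f)).
have [i [m [im]]] := pigeonhole (fun k => theory (to_world (K2_ladder k))).
move/(congr1 val)/eq_in_map => thE.
have m0 : 0 < m by apply: leq_trans im.
pose p := to_world (K2_base m0); pose q := to_world (K2_below_base m0).
have qp : (q < p)%O.
  rewrite lt_neqAle world_leE /= above_node in_fset1U eqxx orbT andbT.
  apply/eqP => /(congr1 val) /= /node_inj[_] /fsetP/(_ (ladder m).2).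
  by rewrite !inE eqxx orbT (negbTE (ladder_fresh m)).
have pf : forces p f.
  apply/fP => v; rewrite lt_neqAle world_leE => /andP[/negbTE -> /=].
  by rewrite above_node => /in_ladder[j _ ->]; apply: ga_ladder.
have qf : forces q f.
  apply/forces_indist/pf => [||v]; [exact: ltW|by rewrite /= !label_node|].
  rewrite world_leE /= above_node in_fset1U => /predU1P[->|]; first by left.
  rewrite [X in _ || X]in_fset1U => vq; right.
  case/or3P: vq => [/eqP vp|/eqP vm|vA].
  - by exists p => //; rewrite (_ : v = p) //; apply: val_inj.
  (* Since [i < m], the rung [y_i] lies in [A_m], the set of strict successors of [p]. *)
  - exists (to_world (K2_ladder i)).
      by rewrite world_leE /= above_node ladder_mem ?orbT.
    rewrite (_ : v = to_world (K2_ladder m)); last exact: val_inj.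
    by move=> g /thE /= E; split=> /asboolP; [rewrite E|rewrite -E] => /asboolP.
  - by exists v => //; rewrite world_leE /= above_node vA orbT.
by have := (fP q).1 qf p qp; rewrite /= label_node inE.
Qed.
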